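(* Consider the preorder $\leq$ on finite digraphs given by primitive positive (pp) constructability, and the poset $\mathfrak P_{\mathrm{Digraphs}}$ obtained by identifying $G,H$ whenever $G\le H$ and $H \le G$. The submaximal elements of $\mathfrak P_{\mathrm{Digraphs}}$ are precisely (the classes of) $T_3, C_2, C_3, C_5, \dots$, i.e. $T_3$ together with $C_p$ for all primes $p$. Moreover, if $G$ is a finite digraph that does not have a pp construction in $P_2$ (i.e. $P_2 \not\leq G$), then $G \leq T_3$ or $G \leq C_p$ for some prime $p$.
   Context: A digraph is a pair $H=(V,E)$ with $E\subseteq V^2$; finite means $V$ finite. A homomorphism $G\to H$ is a map on vertices sending edges to edges; $G,H$ are homomorphically equivalent if there are homomorphisms both ways. A primitive positive formula is a formula $\exists y_1,\dots,y_n(\psi_1\wedge\dots\wedge\psi_m)$ where each $\psi_i$ is $\bot$, $z_1=z_2$, or $E(z_1,z_2)$ with variables $z_1,z_2$ among the free and quantified variables. For a digraph $H=(V,E)$, a pp power of $H$ of dimension $d$ is a digraph with vertex set $V^d$ whose edge set is $\{(u,v)\in V^d\times V^d : \phi(u_1,\dots,u_d,v_1,\dots,v_d)\text{ holds in }H\}$ for some pp formula $\phi(x_1,\dots,x_d,y_1,\dots,y_d)$. We write $H\le G$ (“$H$ pp constructs $G$”, “$G$ has a pp construction in $H$”) if $G$ is homomorphically equivalent to some pp power of $H$; $H<G$ means $H\le G$ and not $G\le H$. $P_k$ is the directed path with vertices $\{0,\dots,k-1\}$ and edges $(i,i+1)$; so $P_1$ is one vertex with no edges, $P_2$ is two vertices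 with one edge. $C_k=(\mathbb Z_k,\{(u,v): v=u+1 \bmod k\})$ is the directed cycle. $T_3=(\{0,1,2\},<)$ is the transitive tournament on three vertices. An element $G$ of $\mathfrak P_{\mathrm{Digraphs}}$ is called submaximal if it is a greatest lower bound of $P_2$ in the sense that $G<P_2$ and there is no $H$ with $G<H<P_2$.
   Formalization: Digraphs are taken to have a nonempty vertex set; for the empty digraph the ''moreover'' part fails, since it has no pp construction in P_2 yet pp constructs neither T_3 nor any C_p. *)

(* Defs.v *)
From mathcomp Require Import all_boot.
Set Implicit Arguments. Unset Strict Implicit. Unset Printing Implicit Defensive.

(* A finite digraph: finite vertex type, edge relation; nonempty vertex set
   (witness dwit). *)
Record digraph := Digraph { dvert : finType; dedge : rel dvert; dwit : dvert }.

Definition hom (G H : digraph) :=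
  exists f : dvert G -> dvert H,
    forall x y, dedge x y -> dedge (f x) (f y).
Definition hom_equiv (G H : digraph) := hom G H /\ hom H G.

Inductive atom (k : nat) :=
| AFalse : atom k
| AEq : 'I_k -> 'I_k -> atom k
| AEdge : 'I_k -> 'I_k -> atom k.

(* pp formula with k free variables: exists y_1..y_n (psi_1 /\ ... /\ psi_m) *)
Record ppformula (k : nat) := PPFormula {
  pp_nex : nat;
  pp_atoms : seq (atom (k + pp_nex)) }.

Definition atom_eval (G : digraph) k (env : 'I_k -> dvert G) (a : atom k) : bool :=
  match a with
  | AFalse => false
  | AEq i j => env i == env j
  | AEdge i j => dedge (env i) (env j)
  end.

Definition join_env (T : Type) k n (x : 'I_k -> T) (y : 'I_n -> T) (i : 'I_(k + n)) : T :=
  match split i with inl a => x a | inr b => y b end.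

Definition pp_holds (G : digraph) k (phi : ppformula k) (x : 'I_k -> dvert G) : bool :=
  [exists y : {ffun 'I_(pp_nex phi) -> dvert G},
     all (atom_eval (join_env x y)) (pp_atoms phi)].

Definition pp_power (G : digraph) (d : nat) (phi : ppformula (d + d)) : digraph :=
  @Digraph {ffun 'I_d -> dvert G}
    (fun u v => pp_holds phi (join_env u v))
    [ffun _ => dwit G].

Definition ppc (H G : digraph) :=
  exists (d : nat) (phi : ppformula (d + d)), hom_equiv G (@pp_power H d phi).
Definition pplt (H G : digraph) := ppc H G /\ ~ ppc G H.
Definition ppeq (H G : digraph) := ppc H G /\ ppc G H.

Definition P2 : digraph :=
  @Digraph 'I_2 (fun i j => (val i == 0) && (val j == 1)) ord0.
Definition T3 : digraph :=
  @Digraph 'I_3 (fun i j => val i < val j) ord0.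
(* directed cycle C_n (meaningful for n >= 1): vertices 0..n-1 *)
Definition Cyc (n : nat) : digraph :=
  @Digraph 'I_n.-1.+1 (fun i j => val j == (val i).+1 %% n) ord0.

Definition submaximal (G : digraph) :=
  pplt G P2 /\ ~ (exists H, pplt G H /\ pplt H P2).

(* Main.v *)
Require Import Defs.
From mathcomp Require Import all_boot zify.
From Stdlib Require Import Classical.
Set Implicit Arguments. Unset Strict Implicit. Unset Printing Implicit Defensive.

(** Replace [G] by its core, so that constants may be used in pp formulas. If
    some power [E^k] of the edge relation is not rectangular, witnessed by
    [a -> c <- b -> d] without [a -> d], then a power with constants [a], [d] is
    homomorphically equivalent to [T3]. If all [E^k] are rectangular, there are
    three cases. A loop gives [P2 <= G]. If the shortest closed walk has length
    [n > 1], rectangularity makes the length of a walk between two vertices on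
    closed [n]-walks well defined modulo [n], whence [G <= C_p] for each prime
    [p] dividing [n]. If there is no closed walk, contracting the complete
    bipartite blocks of [E] shows by induction that [G] is equivalent to a
    directed path, which [P2] constructs as a shift register.
    The digraphs [P2], [T3] and [C_p] are told apart by the quasi Maltsev and
    cyclic minor conditions, which are inherited along pp constructions. *)

(** * Primitive positive definability *)

Definition sum_env (T I J : Type) (x : I -> T) (y : J -> T) (s : I + J) : T :=
  match s with inl i => x i | inr j => y j end.

(** Variables come from an arbitrary type, so that sums and products can index them without
    arithmetic on ordinals. *)
Inductive gatom (T : Type) :=
| GFalse : gatom T
| GEq : T -> T -> gatom T
| GEdge : T -> T -> gatom T.
Arguments GFalse {T}.

Definition gatom_map (T U : Type) (f : T -> U) (a : gatom T) : gatom U :=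
  match a with
  | GFalse => GFalse
  | GEq i j => GEq (f i) (f j)
  | GEdge i j => GEdge (f i) (f j)
  end.

Definition gatom_holds (G : digraph) (T : Type) (env : T -> dvert G)
    (a : gatom T) : Prop :=
  match a with
  | GFalse => False
  | GEq i j => env i = env j
  | GEdge i j => dedge (env i) (env j)
  end.

Fixpoint sat (G : digraph) (T : Type) (env : T -> dvert G) (s : seq (gatom T)) :=
  if s is a :: s' then gatom_holds env a /\ sat env s' else True.

Lemma sat_cat (G : digraph) (T : Type) (env : T -> dvert G) s t :
  sat env (s ++ t) <-> sat env s /\ sat env t.
Proof. by elim: s => [|a s IH] /=; [tauto | rewrite IH; tauto]. Qed.

Lemma sat_map (G : digraph) (T U : Type) (f : T -> U) (env : U -> dvert G) s :
  sat env (map (gatom_map f) s) <-> sat (env \o f) s.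
Proof. by elim: s => [|a s IH] //=; rewrite IH; case: a. Qed.

Lemma eq_sat (G : digraph) (T : Type) (env env' : T -> dvert G) s :
  env =1 env' -> sat env s -> sat env' s.
Proof.
move=> eqe; elim: s => [|a s IH] //= [ha /IH hs]; split=> //.
by case: a ha => //= i j; rewrite !eqe.
Qed.

Lemma sat_hom (G H : digraph) (f : dvert G -> dvert H) (T : Type)
    (env : T -> dvert G) s :
  (forall x y, dedge x y -> dedge (f x) (f y)) ->
  sat env s -> sat (f \o env) s.
Proof.
move=> hf; elim: s => [|a s IH] //= [ha /IH hs]; split=> //.
by case: a ha => //= i j => [->|/hf].
Qed.

Definition ppdef (G : digraph) (I : Type) (R : (I -> dvert G) -> Prop) :=
  exists (J : finType) (s : seq (gatom (I + J))),
    forall x, R x <-> exists y : J -> dvert G, sat (sum_env x y) s.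

Section PPDefinable.

Variable G : digraph.
Local Notation V := (dvert G).

Lemma ppdef_iff (I : Type) (R S : (I -> V) -> Prop) :
  (forall x, R x <-> S x) -> ppdef R -> ppdef S.
Proof.
by move=> eqRS [J [s hs]]; exists J, s => x; rewrite -eqRS.
Qed.

Lemma ppdef_ext (I : Type) (R : (I -> V) -> Prop) x y :
  ppdef R -> x =1 y -> R x -> R y.
Proof.
move=> [J [s hs]] eqxy /hs [z hz]; apply/hs; exists z.
by apply: eq_sat hz => -[i|j] /=.
Qed.

Lemma ppdef_hom (I : Type) (R : (I -> V) -> Prop) (f : V -> V) x :
  ppdef R -> (forall a b, dedge a b -> dedge (f a) (f b)) ->
  R x -> R (f \o x).
Proof.
move=> [J [s hs]] hf /hs [z hz]; apply/hs; exists (f \o z).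
by apply: (eq_sat _ (sat_hom hf hz)) => -[i|j].
Qed.

Lemma ppdef_atoms (I : Type) (s : seq (gatom I)) :
  ppdef (fun x : I -> V => sat x s).
Proof.
exists void, (map (gatom_map inl) s) => x; split.
  by move=> hs; exists (fun v : void => match v with end); rewrite sat_map.
by case=> y; rewrite sat_map.
Qed.

Lemma ppdef_true (I : Type) : ppdef (fun _ : I -> V => True).
Proof. exact: (@ppdef_atoms I [::]). Qed.

Lemma ppdef_false (I : Type) : ppdef (fun _ : I -> V => False).
Proof. by apply: ppdef_iff (@ppdef_atoms I [:: GFalse]) => x /=; tauto. Qed.

Lemma ppdef_eq (I : Type) (i j : I) : ppdef (fun x : I -> V => x i = x j).
Proof. by apply: ppdef_iff (@ppdef_atoms I [:: GEq i j]) => x /=; tauto. Qed.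

Lemma ppdef_edge (I : Type) (i j : I) :
  ppdef (fun x : I -> V => dedge (x i) (x j)).
Proof. by apply: ppdef_iff (@ppdef_atoms I [:: GEdge i j]) => x /=; tauto. Qed.

Lemma ppdef_and (I : Type) (R S : (I -> V) -> Prop) :
  ppdef R -> ppdef S -> ppdef (fun x => R x /\ S x).
Proof.
move=> [J [s hs]] [K [t ht]].
pose f u : I + (J + K) := match u with inl i => inl i | inr j => inr (inl j) end.
pose g u : I + (J + K) := match u with inl i => inl i | inr k => inr (inr k) end.
exists (J + K)%type, (map (gatom_map f) s ++ map (gatom_map g) t) => x.
split=> [[/hs [y hy] /ht [z hz]]|[y]].
  exists (sum_env y z); rewrite sat_cat !sat_map; split.
    by apply: eq_sat hy => -[].
  by apply: eq_sat hz => -[].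
rewrite sat_cat !sat_map => -[hy hz]; split.
  by apply/hs; exists (y \o inl); apply: eq_sat hy => -[].
by apply/ht; exists (y \o inr); apply: eq_sat hz => -[].
Qed.

Lemma ppdef_sub (I I' : Type) (f : I -> I') (R : (I -> V) -> Prop) :
  ppdef R -> ppdef (fun x : I' -> V => R (x \o f)).
Proof.
move=> [J [s hs]].
pose g u : I' + J := match u with inl i => inl (f i) | inr j => inr j end.
exists J, (map (gatom_map g) s) => x; rewrite hs.
by split=> -[y hy]; exists y; move: hy; rewrite sat_map; apply: eq_sat => -[].
Qed.

Lemma ppdef_ex (I : Type) (K : finType) (R : (I + K -> V) -> Prop) :
  ppdef R -> ppdef (fun x : I -> V => exists y : K -> V, R (sum_env x y)).
Proof.
move=> [J [s hs]].
pose f (u : (I + K) + J) : I + (K + J) :=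
  match u with
  | inl (inl i) => inl i | inl (inr k) => inr (inl k) | inr j => inr (inr j)
  end.
exists (K + J)%type, (map (gatom_map f) s) => x; split.
  move=> [y /hs [z hz]]; exists (sum_env y z).
  by rewrite sat_map; apply: eq_sat hz => -[[]|].
move=> [y]; rewrite sat_map => hy; exists (y \o inl); apply/hs.
by exists (y \o inr); apply: eq_sat hy => -[[]|].
Qed.

Lemma ppdef_ex1 (I : Type) (R : (I + unit -> V) -> Prop) :
  ppdef R -> ppdef (fun x : I -> V => exists v : V, R (sum_env x (fun=> v))).
Proof.
move=> hR; apply: ppdef_iff (ppdef_ex hR) => x; split=> [[y hy]|[v hv]].
  by exists (y tt); apply: ppdef_ext hR _ hy => -[i|[]].
by exists (fun=> v).
Qed.

(** A finite conjunction: [k] indexes conjuncts and is not a variable of the formula. *)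
Lemma ppdef_all (I : Type) (K : finType) (R : K -> (I -> V) -> Prop) :
  (forall k, ppdef (R k)) -> ppdef (fun x => forall k, R k x).
Proof.
move=> hR.
have h (s : seq K) : ppdef (fun x => forall k, k \in s -> R k x).
  elim: s => [|a s IH].
    by apply: ppdef_iff (ppdef_true I).
  apply: ppdef_iff (ppdef_and (hR a) IH) => x; split.
    by case=> h1 h2 k; rewrite inE => /predU1P[->|/h2].
  by move=> h; split=> [|k hk]; apply: h; rewrite inE ?eqxx ?hk ?orbT.
apply: ppdef_iff (h (enum K)) => x; split=> h1 k; last by move=> _; apply: h1.
by apply: h1; rewrite mem_enum.
Qed.

Lemma ppdef_implyb (I : Type) (b : bool) (R : (I -> V) -> Prop) :
  ppdef R -> ppdef (fun x => b -> R x).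
Proof.
case: b => hR; first by apply: ppdef_iff hR => x; split=> [|h] //; apply: h.
by apply: ppdef_iff (ppdef_true I).
Qed.

Definition atom_gatom (k n : nat) (a : atom (k + n)) : gatom ('I_k + 'I_n) :=
  match a with
  | AFalse => GFalse
  | AEq i j => GEq (split i) (split j)
  | AEdge i j => GEdge (split i) (split j)
  end.

Lemma atom_gatomP k n (x : 'I_k -> V) (y : 'I_n -> V) s :
  all (atom_eval (join_env x y)) s <-> sat (sum_env x y) (map (@atom_gatom k n) s).
Proof.
have je i : join_env x y i = sum_env x y (split i).
  by rewrite /join_env; case: (split i).
elim: s => [|a s IH] //=; rewrite -IH.
case: a => [|i j|i j] /=; rewrite ?je; split.
- by [].
- by case.
- by case/andP=> /eqP.
- by case=> /eqP-> ->.
- by case/andP.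
- by case=> -> ->.
Qed.

Lemma pp_holds_ppdef k (phi : ppformula k) :
  ppdef (fun x : 'I_k -> V => pp_holds phi x).
Proof.
exists 'I_(pp_nex phi), (map (@atom_gatom k _) (pp_atoms phi)) => x.
split=> [/existsP[y hy]|[y hy]].
  by exists y; apply/atom_gatomP.
apply/existsP; exists (finfun y); apply/atom_gatomP.
by apply: eq_sat hy => -[i|j] //=; rewrite ffunE.
Qed.

Definition gatom_atom (k : nat) (J : finType) (a : gatom ('I_k + J)) :
    atom (k + #|J|) :=
  let f (u : 'I_k + J) :=
    match u with inl i => lshift _ i | inr j => rshift _ (enum_rank j) end in
  match a with
  | GFalse => @AFalse _
  | GEq i j => AEq (f i) (f j)
  | GEdge i j => AEdge (f i) (f j)
  end.

Lemma join_envl (T : Type) k n (x : 'I_k -> T) (y : 'I_n -> T) i :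
  join_env x y (lshift n i) = x i.
Proof. by rewrite /join_env -[lshift n i]/(unsplit (inl i)) unsplitK. Qed.

Lemma join_envr (T : Type) k n (x : 'I_k -> T) (y : 'I_n -> T) i :
  join_env x y (rshift k i) = y i.
Proof. by rewrite /join_env -[rshift k i]/(unsplit (inr i)) unsplitK. Qed.

Lemma ppdef_pp_holds k (R : ('I_k -> V) -> Prop) :
  ppdef R -> exists phi : ppformula k, forall x, pp_holds phi x <-> R x.
Proof.
move=> [J [s hs]].
exists (PPFormula (map (@gatom_atom k J) s)) => x.
have satE (y : {ffun 'I_#|J| -> V}) :
    all (atom_eval (join_env x y)) (map (@gatom_atom k J) s)
    <-> sat (sum_env x (y \o enum_rank)) s.
  elim: {hs} s => [|a s IH] //=; rewrite -IH.
  have je (u : 'I_k + J) : join_env x y (match u with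
      | inl i => lshift _ i | inr j => rshift _ (enum_rank j) end)
      = sum_env x (y \o enum_rank) u.
    by case: u => [i|j]; rewrite ?join_envl ?join_envr.
  case: a => [|i j|i j] /=; rewrite ?je; split.
  - by [].
  - by case.
  - by case/andP=> /eqP.
  - by case=> /eqP-> ->.
  - by case/andP.
  - by case=> -> ->.
rewrite hs; split=> [/existsP[y /satE hy]|[y hy]].
  by exists (y \o enum_rank).
apply/existsP; exists [ffun i => y (enum_val i)]; apply/satE.
by apply: eq_sat hy => -[i|j] //=; rewrite ffunE enum_rankK.
Qed.

End PPDefinable.

(** * The pp construction preorder *)

Lemma pp_power_hom (G H : digraph) d (phi : ppformula (d + d)) :
  hom G H -> hom (pp_power G phi) (pp_power H phi).
Proof.
move=> [f hf]; exists (fun u : {ffun 'I_d -> dvert G} => [ffun i => f (u i)]) => u v /existsP[y] /=.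
move/atom_gatomP/(sat_hom hf) => hy; apply/existsP.
exists [ffun i => f (y i)]; apply/atom_gatomP; apply: eq_sat hy.
case=> [i|j] /=; last by rewrite ffunE.
by rewrite /join_env; case: (split i) => j; rewrite ffunE.
Qed.

Lemma hom_trans (G H K : digraph) : hom G H -> hom H K -> hom G K.
Proof. by move=> [f hf] [g hg]; exists (g \o f) => x y /hf/hg. Qed.

Lemma hom_equiv_trans (G H K : digraph) :
  hom_equiv G H -> hom_equiv H K -> hom_equiv G K.
Proof.
by move=> [h1 h2] [h3 h4]; split; [apply: hom_trans h1 h3 | apply: hom_trans h4 h2].
Qed.

(** Coordinates of the power are indexed by [D]; [f] and [g] give the two homomorphisms, and [g] is
    unconstrained on tuples that lie on no edge. *)
Lemma ppc_intro (G X : digraph) (D : finType)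
    (R : (D + D -> dvert G) -> Prop)
    (f : dvert X -> D -> dvert G) (g : (D -> dvert G) -> dvert X) :
  ppdef R ->
  (forall x y, dedge x y -> R (sum_env (f x) (f y))) ->
  (forall u v, R (sum_env u v) -> dedge (g u) (g v)) ->
  ppc G X.
Proof.
move=> hR hf hg.
pose r (u : D + D) : 'I_(#|D| + #|D|) :=
  match u with inl i => lshift _ (enum_rank i) | inr i => rshift _ (enum_rank i) end.
have [phi hphi] := ppdef_pp_holds (ppdef_sub r hR).
exists #|D|, phi; split.
  exists (fun x => [ffun i => f x (enum_val i)]) => x y /hf hxy /=.
  apply/hphi; apply: ppdef_ext hR _ hxy => -[i|i] /=.
    by rewrite join_envl ffunE enum_rankK.
  by rewrite join_envr ffunE enum_rankK.
exists (fun u : {ffun 'I_#|D| -> dvert G} => g (u \o enum_rank)) => u v /= /hphi huv; apply: hg.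
apply: ppdef_ext hR _ huv => -[i|i] /=.
  by rewrite join_envl.
by rewrite join_envr.
Qed.

Section FlattenPower.

Variables (G : digraph) (d : nat) (psi : ppformula (d + d)).
Local Notation W := (pp_power G psi).

Definition unflatten (T : Type) (z : T * 'I_d -> dvert G) (t : T) : dvert W :=
  [ffun j => z (t, j)].

(** Equality in the power is [d] equalities in [G], and an edge of the power is an instance of
    [psi]. *)
Lemma ppdef_flatten_sat (T : Type) (s : seq (gatom T)) :
  ppdef (fun z : T * 'I_d -> dvert G => sat (unflatten z) s).
Proof.
elim: s => [|a s IH] /=; first exact: ppdef_true.
apply: ppdef_and IH; case: a => [|t t'|t t'] /=.
- exact: ppdef_false.
- have h := ppdef_all (fun j : 'I_d => ppdef_eq G (t, j) (t', j)).
  apply: ppdef_iff h => z.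
  split=> [h|/ffunP h j]; first by apply/ffunP=> j; rewrite !ffunE.
  by have := h j; rewrite !ffunE.
- pose r (i : 'I_(d + d)) : T * 'I_d :=
    match split i with inl j => (t, j) | inr j => (t', j) end.
  apply: ppdef_iff (ppdef_sub r (pp_holds_ppdef G psi)) => z.
  suff e : z \o r =1 join_env (unflatten z t) (unflatten z t').
    split; apply: (ppdef_ext (pp_holds_ppdef G psi)) => // i; exact/esym/e.
  by move=> i; rewrite /r /join_env /=; case: (split i) => j; rewrite ffunE.
Qed.

Lemma ppdef_flatten (I : Type) (R : (I -> dvert W) -> Prop) :
  ppdef R -> ppdef (fun z : I * 'I_d -> dvert G => R (unflatten z)).
Proof.
move=> [J [s hs]].
pose r (u : (I + J) * 'I_d) : I * 'I_d + J * 'I_d :=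
  match u with (inl i, j) => inl (i, j) | (inr i, j) => inr (i, j) end.
apply: ppdef_iff (ppdef_ex (ppdef_sub r (ppdef_flatten_sat s))) => z.
rewrite hs; split=> [[y hy]|[y hy]].
  exists (unflatten y); apply: eq_sat hy.
  by case=> [i|i]; apply/ffunP=> j; rewrite !ffunE.
exists (fun u => (y u.1 : {ffun 'I_d -> dvert G}) u.2); apply: eq_sat hy.
by case=> [i|i]; apply/ffunP=> j; rewrite !ffunE.
Qed.

End FlattenPower.

(** A power of a power flattens to one of dimension [e * d]; [pp_power_hom] lifts the inner
    homomorphisms through the outer power. *)
Lemma ppc_trans (G H K : digraph) : ppc G H -> ppc H K -> ppc G K.
Proof.
move=> [d [psi [HG GH]]] [e [phi [KH HK]]].
have [f hf] : hom K (pp_power (pp_power G psi) phi).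
  exact: hom_trans KH (pp_power_hom _ HG).
have [g hg] : hom (pp_power (pp_power G psi) phi) K.
  exact: hom_trans (pp_power_hom _ GH) HK.
pose r (u : 'I_(e + e) * 'I_d) : 'I_e * 'I_d + 'I_e * 'I_d :=
  match split u.1 with inl i => inl (i, u.2) | inr i => inr (i, u.2) end.
have hphi := pp_holds_ppdef (pp_power G psi) phi.
pose f' x (u : 'I_e * 'I_d) : dvert G :=
  (f x : {ffun 'I_e -> {ffun 'I_d -> dvert G}}) u.1 u.2.
pose g' (u : 'I_e * 'I_d -> dvert G) : dvert K := 
  g (finfun (unflatten psi u) : {ffun 'I_e -> dvert (pp_power G psi)}).
apply: (ppc_intro (ppdef_sub r (ppdef_flatten hphi)) (f := f') (g := g')).
  move=> x y /hf; apply: (ppdef_ext hphi) => i; apply/ffunP=> j.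
  by rewrite ffunE /join_env /r /=; case: (split i).
move=> u v huv; apply: hg; apply: (ppdef_ext hphi) huv => i; apply/ffunP=> j.
by rewrite ffunE /join_env /r /=; case: (split i) => k /=; rewrite !ffunE.
Qed.

Lemma ppc_hom_equiv (G H X : digraph) : hom_equiv G H -> ppc H X -> ppc G X.
Proof.
move=> [GH HG] [d [phi hX]]; exists d, phi.
by apply: hom_equiv_trans hX _; split; apply: pp_power_hom.
Qed.

Lemma ppc_hom_equivr (G X Y : digraph) : hom_equiv X Y -> ppc G Y -> ppc G X.
Proof. by move=> hXY [d [phi hY]]; exists d, phi; apply: hom_equiv_trans hXY hY. Qed.

(** * Minor conditions *)

(* [Q s t] demands the height-one identity [f (x \o s) = f (x \o t)]. *)
Definition minor_condition (I K : finType) (Q : (I -> K) -> (I -> K) -> Prop)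
    (G : digraph) :=
  exists f : {ffun I -> dvert G} -> dvert G,
    (forall x y : {ffun I -> dvert G},
       (forall i, dedge (x i) (y i)) -> dedge (f x) (f y)) /\
    (forall s t, Q s t -> forall x : K -> dvert G,
       f [ffun i => x (s i)] = f [ffun i => x (t i)]).

(** Conjugating by [h] on the arguments and [g] on the value keeps the identities, because [f]
    occurs exactly once on each side. *)
Lemma minor_condition_hom_equiv (I K : finType) (Q : (I -> K) -> (I -> K) -> Prop) G H :
  hom_equiv G H -> minor_condition Q G -> minor_condition Q H.
Proof.
move=> [[g hg] [h hh]] [f [polf hf]].
exists (fun x => g (f [ffun i => h (x i)])); split.
  by move=> x y hxy; apply/hg/polf => i; rewrite !ffunE; apply: hh.
move=> s t /hf hst x; congr g.
have e r : [ffun i => h ([ffun i => x (r i)] i)] = [ffun i => h (x (r i))] :> {ffun I -> _}.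
  by apply/ffunP=> i; rewrite !ffunE.
by rewrite !e; apply: (hst (h \o x)).
Qed.

(** Apply [f] coordinatewise, and likewise to the witnesses of the quantified variables. *)
Lemma minor_condition_pp_power (I K : finType) (Q : (I -> K) -> (I -> K) -> Prop) G d
    (phi : ppformula (d + d)) (i0 : I) :
  minor_condition Q G -> minor_condition Q (pp_power G phi).
Proof.
move=> [f [polf hf]].
exists (fun u : {ffun I -> {ffun 'I_d -> dvert G}} => [ffun c => f [ffun i => u i c]]); split; last first.
  move=> s t /hf hst x; apply/ffunP=> c; rewrite !ffunE.
  have e r : [ffun i => ([ffun i => x (r i)] : {ffun I -> dvert (pp_power G phi)}) i c]
      = [ffun i => x (r i) c].
    by apply/ffunP=> i; rewrite !ffunE.
  by rewrite !e; apply: (hst (fun k => x k c)).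
move=> u v huv.
pose y i := xchoose (existsP (huv i)).
have hy i : all (atom_eval (join_env (join_env (u i) (v i)) (y i))) (pp_atoms phi).
  exact: (xchooseP (existsP (huv i))).
apply/existsP; exists [ffun c => f [ffun i => y i c]].
pose env i := join_env (join_env (u i) (v i)) (y i).
have eE c : join_env (join_env [ffun c0 => f [ffun i => u i c0]]
    [ffun c0 => f [ffun i => v i c0]]) [ffun c0 => f [ffun i => y i c0]] c
    = f [ffun i => env i c].
  rewrite /env /join_env; case: (split c) => [c'|c']; rewrite ?ffunE //.
  by case: (split c') => c''; rewrite ffunE.
elim: (pp_atoms phi) hy => [//|a s IH] hy /=; apply/andP; split; last first.
  by apply: IH => i; have /andP[] := hy i.
have hai i : atom_eval (env i) a by have /andP[] := hy i.
case: a {hy} hai => [|c c'|c c'] hai /=; rewrite ?eE.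
(* With [I] empty, nothing would exclude the atom [AFalse]. *)
- by have := hai i0.
- apply/eqP; congr f; apply/ffunP=> i; rewrite !ffunE; exact/eqP/(hai i).
- by apply: polf => i; rewrite !ffunE; apply: hai.
Qed.

Lemma minor_condition_ppc (I K : finType) (Q : (I -> K) -> (I -> K) -> Prop) G H (i0 : I) :
  ppc G H -> minor_condition Q G -> minor_condition Q H.
Proof.
move=> [d [phi [HG GH]]] hG.
by apply: minor_condition_hom_equiv (minor_condition_pp_power phi i0 hG).
Qed.

(** * Walks and rectangularity *)

Fixpoint walk (V : finType) (e : rel V) (k : nat) (x y : V) : bool :=
  if k is k'.+1 then [exists z, e x z && walk e k' z y] else x == y.

Definition rectangular (V : Type) (r : rel V) :=
  forall a b c d, r a c -> r b c -> r b d -> r a d.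

Section Walks.

Variables (V : finType) (e : rel V).
Local Notation walk := (walk e).

Lemma walkS k x y : reflect (exists2 z, e x z & walk k z y) (walk k.+1 x y).
Proof.
apply: (iffP existsP) => [[z /andP[h1 h2]]|[z h1 h2]]; exists z => //.
by rewrite h1.
Qed.

Lemma walk1 x y : walk 1 x y = e x y.
Proof.
by apply/walkS/idP => [[z hz /eqP<-]|h] //; exists y => //=.
Qed.

Lemma walkD m n x y :
  reflect (exists2 z, walk m x z & walk n z y) (walk (m + n) x y).
Proof.
elim: m x => [|m IH] x.
  by apply: (iffP idP) => [h|[z /eqP->]] //; exists x => /=.
apply: (iffP (walkS _ _ _)) => [[z h1 /IH[w h2 h3]]|[w /walkS[z h1 h2] h3]].
  by exists w => //; apply/walkS; exists z.
by exists z => //; apply/IH; exists w.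
Qed.

Lemma walk_cat m n x y z : walk m x y -> walk n y z -> walk (m + n) x z.
Proof. by move=> h1 h2; apply/walkD; exists y. Qed.

Lemma walk_mul k n x : walk n x x -> walk (k * n) x x.
Proof. by move=> h; elim: k => [|k IH] /=; rewrite ?mulSn //; apply: walk_cat h IH. Qed.

Lemma walk_seq k x y : walk k x y ->
  exists w : nat -> V, [/\ w 0 = x, w k = y & forall i, i < k -> e (w i) (w i.+1)].
Proof.
elim: k x => [|k IH] x; first by move/eqP=> <-; exists (fun=> x).
case/walkS=> z hxz /IH[w [w0 wk hw]].
by exists (fun i => if i is j.+1 then w j else x); split=> // -[|i] //; [rewrite w0 | apply: hw].
Qed.

Lemma seq_walk (w : nat -> V) k i : (forall j, j < k -> e (w j) (w j.+1)) ->
  forall n, i + n <= k -> walk n (w i) (w (i + n)).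
Proof.
move=> hw; elim=> [|n IH] hn; first by rewrite addn0 /=.
rewrite addnS -addn1; apply: walk_cat (IH _) _; first by rewrite ltnW // -addnS.
by rewrite walk1 hw // -addnS.
Qed.

(** Pigeonhole: the [k + 1] vertices of the walk cannot all differ. *)
Lemma walk_cyclic k x y : #|V| <= k -> walk k x y ->
  exists z n, 0 < n /\ walk n z z.
Proof.
move=> hk /walk_seq[w [_ _ hw]].
have : ~~ injectiveb (fun i : 'I_k.+1 => w i).
  apply/negP=> /injectiveP/leq_card; rewrite card_ord => /(leq_ltn_trans _).
  by move/(_ _ hk); rewrite ltnn.
case/injectivePn=> i [j]; wlog lij : i j / i < j => [h|].
  have [/h//|/h h1|/val_inj-> /eqP//] := ltngtP i j.
  by rewrite eq_sym => ne eqw; apply: h1.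
move=> _ eqw; exists (w i), (j - i); rewrite subn_gt0; split=> //.
have := seq_walk hw (i := i) (n := j - i); rewrite subnKC ?(ltnW lij) //.
by rewrite -eqw; apply; rewrite -ltnS.
Qed.

Hypothesis rect : forall k, rectangular (walk k).

(* Following one edge out of [v] and, by rectangularity, a matching edge out of
   [s] lowers [k] by one while preserving the length [q]. *)
Lemma closed_walk_of_common_target k q v s c : 0 < q ->
  walk q v s -> walk k s c -> walk k v c -> exists z, walk q z z.
Proof.
move=> q0; elim: k v s c => [|k IH] v s c.
  by move=> hvs /eqP hs /eqP hv; exists v; rewrite {2}hv -hs.
case: q q0 IH => // q _ IH /walkS[v1 hv hv1s] hsc hvc.
(* The vertex [f] reached after [k] steps on the walk from [v1] through [s] to [c] becomes the new
   common target. *)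
have /walkD[f hf _] : walk (k + q.+1) v1 c.
  by rewrite addnC addSnnS; apply: walk_cat hv1s hsc.
have hvf : walk k.+1 v f by apply/walkS; exists v1.
have /walkS[s' hs hs'] := rect hsc hvc hvf.
apply: (IH v1 s' f) => //.
by rewrite -addn1; apply: walk_cat hv1s _; rewrite walk1.
Qed.

(** By Bezout, some multiple of [m] is [b * n + g] with [g] the gcd. Cut that closed walk after [g]
    steps, at [s]: both [s] and [x] reach [x] in [b * n] steps, so there is a closed walk of length
    [g], and minimality gives [n = g]. *)
Lemma girth_dvd_closed n x m : 0 < n ->
  (forall k z, 0 < k -> walk k z z -> n <= k) ->
  walk n x x -> walk m x x -> n %| m.
Proof.
move=> n0 girth hn hm; case: m hm => // m hm.
have [a b hab _ ] := egcdnP n (ltn0Sn m).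
set g := gcdn _ _ in hab.
have g0 : 0 < g by rewrite gcdn_gt0.
have /walkD[s hxs hsx] : walk (g + b * n) x x.
  by rewrite addnC -hab; apply: walk_mul.
have [z hz] := closed_walk_of_common_target g0 hxs hsx (walk_mul b hn).
have hng := girth _ _ g0 hz.
have -> : n = g.
  by apply/eqP; rewrite eqn_leq hng dvdn_leq // dvdn_gcdr.
exact: dvdn_gcdl.
Qed.

(** Going round the closed walks [M] times yields [x -> z -> x] and [y -> w -> y], with [x -> z] and
    [w -> y] of length [M]. Rectangularity supplies [w -> z], and the return is
    [y -> w -> z -> x]. *)
Lemma walk_back n x y M : 0 < n -> walk n x x -> walk n y y -> walk M x y ->
  exists M', walk M' y x.
Proof.
move=> n0 hx hy hxy.
have hle : M * n = M + M * n.-1 by rewrite -mulnS prednK.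
have /walkD[z hxz hzx] : walk (M + M * n.-1) x x by rewrite -hle; apply: walk_mul.
have /walkD[w hyw hwy] : walk (M * n.-1 + M) y y by rewrite addnC -hle; apply: walk_mul.
exists (M * n.-1 + (M + M * n.-1)).
exact: walk_cat hyw (walk_cat (rect hwy hxy hxz) hzx).
Qed.

(* Vertices on closed walks of length the girth [n] are labelled by the length
   modulo [n] of a walk from a chosen representative of their component. *)
Lemma girth_label n : 0 < n ->
  (forall k z, 0 < k -> walk k z z -> n <= k) ->
  exists f : V -> nat, forall x y m,
    walk n x x -> walk n y y -> walk m x y -> f y = f x + m %[mod n].
Proof.
move=> n0 girth.
pose T x := walk n x x.
have connP x y : reflect (exists M, walk M x y) (connect e x y).
  apply: (iffP connectP) => [[p hp ->]|[M]].
    elim: p x hp => [|z p IH] x /=; first by exists 0 => /=.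
    by case/andP=> hxz /IH[M hM]; exists M.+1; apply/walkS; exists z.
  elim: M x => [|M IH] x; first by move/eqP->; exists [::].
  by case/walkS=> z hxz /IH[p hp ->]; exists (z :: p) => //=; rewrite hxz.
pose P x r := T r && connect e r x.
pose rep x := odflt x (pick (P x)).
have repP x : T x -> T (rep x) && connect e (rep x) x.
  by move=> Tx; rewrite /rep; case: pickP => //= _; rewrite Tx connect0.
have rep_eq x y m : T x -> T y -> walk m x y -> rep x = rep y.
  move=> Tx Ty hm; rewrite /rep.
  have cxy : connect e x y by apply/connP; exists m.
  have cyx : connect e y x by apply/connP; exact: (walk_back n0 Tx Ty hm).
  (* Mutually reachable vertices define the same predicate, so [pick] returns the same
     representative. *)
  have /eq_pick-> : P x =1 P y.
    move=> r; rewrite /P; congr (_ && _); apply/idP/idP => h.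
      exact: connect_trans cxy.
    exact: connect_trans cyx.
  by case: (pickP (P y)) => [//|/(_ y)]; rewrite /P Ty connect0.
(* The implication makes a length exist at every vertex, as [ex_minn] requires. *)
have lenP x : exists M, T x ==> walk M (rep x) x.
  case Tx: (T x); last by exists 0.
  by have /andP[_ /connP] := repP x Tx.
exists (fun x => ex_minn (lenP x)) => x y m Tx Ty hm.
case: ex_minnP => M /implyP/(_ Ty) hM _; case: ex_minnP => M' /implyP/(_ Tx) hM' _.
have /andP[Tr _] := repP y Ty; rewrite (rep_eq _ _ _ Tx Ty hm) in hM'.
have hM'' := walk_cat hM' hm.
(* One return walk closes both walks from the representative to [y]; both closed lengths are
   divisible by [n]. *)
have [B hB] := walk_back n0 Tr Ty hM.
have /eqP d1 : n %| M + B by exact: (girth_dvd_closed n0 girth Tr (walk_cat hM hB)).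
have /eqP d2 : n %| M' + m + B by exact: (girth_dvd_closed n0 girth Tr (walk_cat hM'' hB)).
by apply/eqP; rewrite -(eqn_modDr B) d1 d2.
Qed.

End Walks.

(** Induction on the bound [k]: passing to blocks lowers it by one, and levels of blocks pull back
    to vertices. *)
Lemma rectangular_level (V : finType) k (e : rel V) :
  (forall j, rectangular (walk e j)) ->
  (forall x y, ~~ walk e k.+1 x y) ->
  exists f : V -> nat, (forall x y, e x y -> f y = (f x).+1) /\ (forall x, f x <= k).
Proof.
elim: k e => [|k IH] e rect nowalk.
  exists (fun=> 0); split=> // x y hxy.
  by have := nowalk x y; rewrite walk1 hxy.
have rect1 a b c d : e a c -> e b c -> e b d -> e a d.
  by have := @rect 1 a b c d; rewrite !walk1.
(* Contract each complete bipartite block of [e] to its set of sources; a walk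
   of length [j] between blocks is a walk of length [j + 1] in [e]. *)
pose e' a b := [exists v, exists w, [&& e a v, e v w & e b w]].
have e'P a b : reflect (exists v w, [/\ e a v, e v w & e b w]) (e' a b).
  apply: (iffP existsP) => [[v /existsP[w /and3P[]]]|[v [w [h1 h2 h3]]]].
    by exists v, w.
  by exists v; apply/existsP; exists w; apply/and3P.
have walk'P j a b : walk e' j.+1 a b <-> exists2 c, walk e j.+2 a c & e b c.
  elim: j a => [|j IHj] a.
    rewrite walk1; split=> [/e'P[v [w [h1 h2 h3]]]|[w /walkS[v h1 ]]].
      exists w => //; apply/walkS; exists v => //; by rewrite walk1.
    by rewrite walk1 => h2 h3; apply/e'P; exists v, w.
  split=> [/walkS[z /e'P[v [w [h1 h2 h3]]] /IHj[c /walkS[u h4 h5] h6]]|].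
    exists c => //; apply/walkS; exists v => //; apply/walkS; exists u => //.
    exact: rect1 h2 h3 h4.
  case=> c /walkS[v h1 /walkS[w h2 h3]] h4; apply/walkS; exists v.
    by apply/e'P; exists v, w.
  by apply/IHj; exists c => //; apply/walkS; exists w.
have rect' j : rectangular (walk e' j).
  case: j => [|j] a b c d; first by move=> /eqP-> /eqP-> .
  move=> /walk'P[u hau hcu] /walk'P[v hbv hcv] /walk'P[w hbw hdw].
  apply/walk'P; exists w => //.
  apply: (rect _ _ b v) => //.
  move: hau; rewrite -[j.+2]addn1 => /walkD[t hat]; rewrite walk1 => htu.
  by apply: walk_cat hat _; rewrite walk1; apply: rect1 htu hcu hcv.
have nowalk' x y : ~~ walk e' k.+1 x y.
  by apply/negP=> /walk'P[c hc _]; rewrite (negPf (nowalk x c)) in hc.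
have [f [hf fk]] := IH e' rect' nowalk'.
pose P v a := [forall w, e a w == e v w].
(* As [f] need not be constant on a block, one canonical member is fixed. *)
pose rep v := odflt v (pick (P v)).
have repE v w : e (rep v) w = e v w.
  rewrite /rep; case: pickP => [a /forallP/(_ w)/eqP //|/(_ v)].
  by move/negP; case; apply/forallP=> z.
have rep_eq u v w : e u w -> e v w -> rep u = rep v.
  move=> huw hvw; rewrite /rep.
  have euv z : e u z = e v z.
    apply/idP/idP => h; first exact: rect1 hvw huw h.
    exact: rect1 huw hvw h.
  have /eq_pick-> : P u =1 P v by move=> a; apply: eq_forallb => z; rewrite euv.
  by case: (pickP (P v)) => [//|/(_ v) /negP]; case; apply/forallP.
(* A sink lies one above the block that points to it; an isolated vertex gets level [0]. *)
pose g v := if [pick w | e v w] then f (rep v)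
            else if [pick u | e u v] is Some u then (f (rep u)).+1 else 0.
exists g; split=> [v w hvw|v]; last first.
  rewrite /g; case: pickP => [w _|_]; first exact/ltnW/fk.
  by case: pickP => [u _|_] //; apply: fk.
have -> : g v = f (rep v).
  by rewrite /g; case: pickP => // /(_ w); rewrite hvw.
rewrite /g; case: pickP => [z hwz|_].
  by apply: hf; apply/e'P; exists w, z; rewrite !repE.
case: pickP => [u huw|/(_ v)]; last by rewrite hvw.
by rewrite (rep_eq _ _ _ huw hvw).
Qed.

Lemma closed_walk_seq (V : finType) (e : rel V) n x : 0 < n -> walk e n x x ->
  exists w : nat -> V, (forall i, e (w i) (w i.+1)) /\ (forall i, w (i + n) = w i).
Proof.
move=> n0 /walk_seq[w [w0 wn hw]]; exists (fun i => w (i %% n)); split=> i.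
  have hi := ltn_pmod i n0.
  suff -> : w (i.+1 %% n) = w (i %% n).+1 by apply: hw.
  rewrite -addn1 -modnDml addn1; move: hi.
  rewrite leq_eqVlt => /orP[/eqP->|/modn_small-> //].
  by rewrite modnn w0 wn.
by rewrite modnDr.
Qed.

Lemma ppdef_walk (G : digraph) (I : Type) k (i j : I) :
  ppdef (fun x : I -> dvert G => walk (@dedge G) k (x i) (x j)).
Proof.
elim: k I i j => [|k IH] I i j.
  by apply: ppdef_iff (ppdef_eq G i j) => x /=; split=> [->|/eqP].
have h := ppdef_ex1 (ppdef_and (ppdef_edge G (inl i) (inr tt)) (IH _ (inr tt) (inl j))).
apply: ppdef_iff h => x; split=> [[v [h1 h2]]|/walkS[v h1 h2]].
  by apply/walkS; exists v.
by exists v.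
Qed.

(** * Cores *)

Definition endo (G : digraph) (f : dvert G -> dvert G) :=
  forall x y, dedge x y -> dedge (f x) (f y).

Definition core (G : digraph) := forall f, @endo G f -> injective f.

(** Induction on the number of vertices: the image of a non-injective endomorphism induces a smaller
    equivalent digraph. *)
Lemma core_exists (G : digraph) : exists2 H, core H & hom_equiv G H.
Proof.
have [n] := ubnP #|dvert G|; elim: n G => // n IH G hn.
case: (boolP [exists f : {ffun dvert G -> dvert G},
    [forall x, forall y, dedge x y ==> dedge (f x) (f y)] && ~~ injectiveb f]).
  case/existsP=> f /andP[hf ninj].
  have {}hf : endo f by move=> x y; apply/implyP; move/forallP/(_ x)/forallP/(_ y): hf.
  pose W : finType := {x | x \in codom f}.
  pose H := @Digraph W (fun x y => dedge (val x) (val y))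
    (exist _ (f (dwit G)) (codom_f f _)).
  have GH : hom_equiv G H.
    split; first by exists (fun x => exist _ (f x) (codom_f f x)) => x y /hf.
    by exists val.
  have /IH[K cK HK] : #|dvert H| < n.
    rewrite -ltnS; apply: leq_trans hn; rewrite ltnS card_sig.
    rewrite ltn_neqAle leq_image_card andbT; apply: contra ninj.
    by move/image_injP=> h; apply/injectiveP=> x y; apply: h.
  by exists K => //; apply: hom_equiv_trans GH HK.
move=> nex; exists G; last by split; exists id.
move=> f hf; have [//|ninj] := classic (injective f).
case/negP: nex; apply/existsP; exists (finfun f).
apply/andP; split.
  by apply/forallP=> x; apply/forallP=> y; apply/implyP; rewrite !ffunE; apply: hf.
apply/negP=> /injectiveP h; apply: ninj => x y exy; apply: h.
by rewrite !ffunE.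
Qed.

(** An injective endomorphism permutes the finite edge set, so each edge [(f x, f y)] comes from the
    edge [(x, y)]. *)
Lemma injective_endo_reflect (G : digraph) (f : dvert G -> dvert G) x y :
  endo f -> injective f -> dedge (f x) (f y) -> dedge x y.
Proof.
move=> hf injf hxy.
pose A := [set p : dvert G * dvert G | dedge p.1 p.2].
pose F (p : dvert G * dvert G) := (f p.1, f p.2).
have injF : injective F by move=> [a b] [c d] [/injf-> /injf->].
have /eqP FA : F @: A == A.
  rewrite eqEcard card_imset // leqnn andbT; apply/subsetP=> p /imsetP[q].
  by rewrite inE => hq ->; rewrite inE; apply: hf.
have : (f x, f y) \in A by rewrite inE.
rewrite -FA => /imsetP[[a b]]; rewrite inE => hab [/injf-> /injf->].
exact: hab.
Qed.

(* The constants are carried along in every vertex of the power: as [G] is a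
   core, each tuple of constants satisfying the edges of [G] is an automorphic
   copy of the identity tuple. *)
Lemma ppc_core_constants (G X : digraph) (D : finType)
    (R : ((D + D) + dvert G -> dvert G) -> Prop)
    (f : dvert X -> D -> dvert G) (g : (D -> dvert G) -> dvert X) :
  core G -> ppdef R ->
  (forall x y, dedge x y -> R (sum_env (sum_env (f x) (f y)) id)) ->
  (forall u v, R (sum_env (sum_env u v) id) -> dedge (g u) (g v)) ->
  ppc G X.
Proof.
move=> cG hR hf hg; pose V := dvert G.
(* Constants are read from the first vertex; the equations in [hS] make the second carry the same
   ones. *)
pose r (u : (D + D) + V) : (D + V) + (D + V) :=
  match u with
  | inl (inl i) => inl (inl i) | inl (inr i) => inr (inl i) | inr v => inl (inr v)
  end.
pose cst (v : V) : (D + V) + (D + V) := inl (inr v).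
have hS := ppdef_and (ppdef_and
  (ppdef_all (fun v : V => ppdef_eq G (cst v) (inr (inr v))))
  (ppdef_all (fun p : V * V => ppdef_implyb (dedge p.1 p.2)
     (ppdef_edge G (cst p.1) (cst p.2)))))
  (ppdef_sub r hR).
pose inv (z : V -> V) y := odflt y [pick a | z a == y].
apply: (ppc_intro hS (f := fun x => sum_env (f x) id)
          (g := fun w => g (inv (w \o inr) \o (w \o inl)))).
  move=> x y hxy; split; first by split=> // -[].
  by apply: ppdef_ext hR _ (hf _ _ hxy) => -[[]|].
move=> u v [[/= eqz hz] huv]; pose z v := u (inr v).
have endz : endo z by move=> a b; apply: (hz (a, b)).
have injz := cG _ endz.
have zinv y : z (inv z y) = y.
  rewrite /inv; case: pickP => [a /eqP //|].
  have /codomP[a ->] : y \in codom z by apply: inj_card_onto injz _ _.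
  by move/(_ a); rewrite eqxx.
have endi : endo (inv z).
  by move=> a b; rewrite -{1}(zinv a) -{1}(zinv b); apply: injective_endo_reflect.
(* The automorphism [inv z] preserves [R] and turns the carried constants [z] into the true ones. *)
apply: hg; apply: ppdef_ext hR _ (ppdef_hom hR endi huv) => -[[i|i]|w] //=.
  rewrite /inv; congr odflt; apply: eq_pick => a /=.
  by rewrite /z eqz.
by apply: injz; rewrite zinv.
Qed.

(** * The dichotomy for digraphs that [P2] does not construct *)

(** The pairs [(b, d)], [(a, d)], [(a, c)] play the roles of [0], [1], [2]. The missing walk from
    [a] to [d] forbids a loop at [(a, d)]. *)
Lemma nonrectangular_ppc_T3 (G : digraph) k :
  core G -> ~ rectangular (walk (@dedge G) k) -> ppc G T3.
Proof.
move=> cG nrect.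
have [a [b [c [d [ac bc bd nad]]]]] : exists a b c d, [/\ walk (@dedge G) k a c,
    walk (@dedge G) k b c, walk (@dedge G) k b d & ~ walk (@dedge G) k a d].
  apply: NNPP => h; apply: nrect => a b c d h1 h2 h3; apply: NNPP => h4.
  by apply: h; exists a, b, c, d.
pose V := dvert G.
pose x1 : (bool + bool) + V := inl (inl true).
pose x2 : (bool + bool) + V := inl (inl false).
pose y1 : (bool + bool) + V := inl (inr true).
pose y2 : (bool + bool) + V := inl (inr false).
have hR := ppdef_and (ppdef_walk G k x1 y2)
  (ppdef_and (ppdef_eq G x2 (inr d)) (ppdef_eq G y1 (inr a))).
pose f (i : 'I_3) (s : bool) : V :=
  if s then (if val i == 0 then b else a) else (if val i == 2 then c else d).
pose g (u : bool -> V) : 'I_3 :=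
  if u false == d then (if u true == a then inord 1 else inord 0) else inord 2.
apply: (@ppc_core_constants G T3 bool _ f g cG hR).
  by case=> [[|[|[|//]]] hx] [[|[|[|//]]] hy].
move=> u v /= [h1 [h2 h3]]; rewrite /g h2 h3 !eqxx.
case: eqP => [h4|h4]; case: eqP => [h5|h5]; rewrite !inordK //.
by case: nad; rewrite -h4 -h5.
Qed.

(** With [n = q * p], join vertices on closed [n]-walks by walks of length [q]. Labels advance by
    [q] modulo [n], so their quotients by [q] advance by one modulo [p]. *)
Lemma rectangular_ppc_Cyc (G : digraph) n x p :
  (forall k, rectangular (walk (@dedge G) k)) -> 0 < n ->
  (forall k z, 0 < k -> walk (@dedge G) k z z -> n <= k) ->
  walk (@dedge G) n x x -> prime p -> p %| n -> ppc G (Cyc p).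
Proof.
move=> rect n0 girth hx pp /dvdnP[q nE].
have p0 := prime_gt0 pp.
have q0 : 0 < q by move: n0; rewrite nE muln_gt0 => /andP[].
have [w [we wn]] := closed_walk_seq n0 hx.
have [lab hlab] := girth_label rect n0 girth.
have walkw i m : walk (@dedge G) m (w i) (w (i + m)).
  exact: (seq_walk (k := i + m) (fun j _ => we j)).
have hR := ppdef_and (ppdef_and (ppdef_walk G n (inl tt) (inl tt))
  (ppdef_walk G n (inr tt) (inr tt))) (ppdef_walk G q (inl tt) (inr tt)).
pose f (i : 'I_p.-1.+1) (_ : unit) := w (i * q).
pose g (u : unit -> dvert G) : 'I_p.-1.+1 := inord (lab (u tt) %/ q %% p).
apply: (@ppc_intro G (Cyc p) unit _ f g hR).
  move=> i j /= /eqP jE; rewrite /f.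
  have cl m : walk (@dedge G) n (w m) (w m) by rewrite -{2}wn; apply: walkw.
  split; first by split; apply: cl.
  suff -> : w (j * q) = w (i * q + q) by apply: walkw.
  rewrite jE addnC -mulSn; have : i < p by apply: leq_trans (ltn_ord i) _; rewrite prednK.
  rewrite leq_eqVlt => /orP[/eqP->|/modn_small-> //].
  by rewrite modnn mul0n mulnC -nE -[n]add0n wn.
move=> u v /= [[hu hv] huv]; rewrite /g /=.
have lt m : m %% p < p.-1.+1 by rewrite prednK // ltn_pmod.
rewrite !inordK //; apply/eqP.
rewrite modn_divl [p * q]mulnC -nE (hlab _ _ _ hu hv huv) nE [q * p]mulnC -modn_divl.
by rewrite divnDr // divnn q0 -modnDml addn1.
Qed.

Lemma ppc_P2_loop (G : digraph) x : @dedge G x x -> ppc P2 G.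
Proof.
move=> hx; have hR := ppdef_true P2 (unit + unit).
exact: (@ppc_intro P2 G unit _ (fun _ _ => dwit P2) (fun=> x) hR).
Qed.

Lemma P2_val1 (x : dvert P2) : (val x == 1) = (x == inord 1).
Proof. by rewrite -val_eqE /= inordK. Qed.

(* A vertex of the power is a register of [k + 1] bits, the last of which is
   [0]; an edge shifts in a [1], so the number of ones is the level. *)
Lemma ppc_P2_level (G : digraph) k (w : nat -> dvert G) (l : dvert G -> nat) :
  (forall i, i < k -> dedge (w i) (w i.+1)) ->
  (forall x y, dedge x y -> l y = (l x).+1) -> (forall x, l x <= k) ->
  ppc P2 G.
Proof.
move=> hw hl lk.
pose I := ('I_k.+1 + 'I_k.+1)%type.
(* In [P2] only [1] has an incoming edge and only [0] an outgoing one. *)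
have isone (i : I) : ppdef (fun x : I -> dvert P2 => x i = inord 1 :> 'I_2).
  have h := ppdef_ex1 (ppdef_edge P2 (inr tt) (inl i)).
  apply: ppdef_iff h => x /=; split=> [[v /andP[_]]|->].
    by rewrite P2_val1 => /eqP.
  by exists ord0; rewrite /= inordK.
have iszero (i : I) : ppdef (fun x : I -> dvert P2 => x i = ord0 :> 'I_2).
  have h := ppdef_ex1 (ppdef_edge P2 (inl i) (inr tt)).
  apply: ppdef_iff h => x /=; split=> [[v /andP[/eqP h0 _]]|->].
    exact: val_inj.
  by exists (inord 1); rewrite /= inordK.
have hR := ppdef_and (ppdef_and (isone (inr ord0))
  (ppdef_and (iszero (inl ord_max)) (iszero (inr ord_max))))
  (ppdef_all (fun i : 'I_k => ppdef_eq P2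
     (inr (lift ord0 i) : I) (inl (widen_ord (leqnSn k) i)))).
pose bit (b : bool) : 'I_2 := if b then inord 1 else ord0.
pose ones (u : 'I_k.+1 -> dvert P2) := \sum_i (u i == inord 1 :> 'I_2).
apply: (@ppc_intro P2 G 'I_k.+1 _ (fun x i => bit (i < l x)) (fun u => w (ones u)) hR).
  move=> x y /hl hxy; split=> /=; first split.
  - by rewrite hxy.
  - by rewrite !ltnNge !lk.
  - by move=> i; rewrite hxy.
have n01 : (ord0 == inord 1 :> 'I_2) = false by rewrite -val_eqE /= inordK.
move=> u v /= [[v0 [uk vk]] uv].
have onesv : ones v = (ones u).+1.
  rewrite {1}/ones big_ord_recl v0 eqxx add1n; congr _.+1.
  rewrite /ones big_ord_recr /= uk n01 addn0.
  by apply: eq_bigr => i _; rewrite uv.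
(* The last bit of [v] is [0], so [v] has at most [k] ones and [w] is used within its range. *)
rewrite onesv; apply: hw; rewrite -onesv.
rewrite /ones big_ord_recr /= vk n01 addn0 -[leqRHS]card_ord -sum1_card.
by apply: leq_sum => i _; apply: leq_b1.
Qed.

Lemma core_dichotomy (G : digraph) : core G -> ~ ppc P2 G ->
  ppc G T3 \/ exists p, prime p /\ ppc G (Cyc p).
Proof.
move=> cG nP2.
have [rect|nrect] := classic (forall k, rectangular (walk (@dedge G) k)); last first.
  have [k hk] := not_all_ex_not _ _ nrect.
  by left; apply: nonrectangular_ppc_T3 hk.
right; have [ex|nex] := classic (exists n, (0 < n) && [exists x, walk (@dedge G) n x x]).
  case: (ex_minnP ex) => n /andP[n0 /existsP[x hx]] nmin.
  have girth k z : 0 < k -> walk (@dedge G) k z z -> n <= k.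
    by move=> k0 hz; apply: nmin; rewrite k0; apply/existsP; exists z.
  case: (ltngtP n 1) => [|n1|n1]; first by rewrite ltnNge n0.
    exists (pdiv n); rewrite pdiv_prime //; split=> //.
    by apply: (rectangular_ppc_Cyc rect n0 girth hx); rewrite ?pdiv_prime ?pdiv_dvd.
  by case: nP2; apply: (@ppc_P2_loop _ x); rewrite -walk1 -n1.
case: nP2.
(* The least such [k] will be the length of a longest walk; one exists by pigeonhole, as there is no
   closed walk. *)
have exk : exists k, ~~ [exists x, exists y, walk (@dedge G) k.+1 x y].
  exists #|dvert G|; apply/negP=> /existsP[x /existsP[y]].
  move/(walk_cyclic (leqnSn _)) => [z [n [n0 hz]]]; apply: nex; exists n.
  by rewrite n0; apply/existsP; exists z.
case: (ex_minnP exk) => k nwk kmin.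
have nowalk x y : ~~ walk (@dedge G) k.+1 x y.
  by apply: contra nwk => h; apply/existsP; exists x; apply/existsP; exists y.
have [l [hl lk]] := rectangular_level rect nowalk.
have [x [y /walk_seq[w [_ _ hw]]]] : exists x y, walk (@dedge G) k x y.
  case: k kmin {nwk nowalk lk} => [|k] kmin; first by exists (dwit G), (dwit G) => /=.
  case: (boolP [exists x, exists y, walk (@dedge G) k.+1 x y]) => [|/kmin].
    by case/existsP=> x /existsP[y hxy]; exists x, y.
  by rewrite ltnn.
exact: ppc_P2_level hw hl lk.
Qed.

Lemma digraph_dichotomy (G : digraph) : ~ ppc P2 G ->
  ppc G T3 \/ exists p, prime p /\ ppc G (Cyc p).
Proof.
move=> nP2; have [H cH GH] := core_exists G.
have nP2H : ~ ppc P2 H by move=> h; apply: nP2; apply: ppc_hom_equivr GH h.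
case: (core_dichotomy cH nP2H) => [h|[p [pp h]]]; [left|right; exists p; split=> //];
  exact: ppc_hom_equiv GH h.
Qed.

(** * Separating the submaximal digraphs *)

Definition triple (T : Type) (x y z : T) (i : 'I_3) : T :=
  if val i == 0 then x else if val i == 1 then y else z.

(* [f (x, x, y) = f (y, z, z)], which at [z := y] and [x := y] gives both
   quasi Maltsev identities. *)
Definition maltsev := @minor_condition 'I_3 (option bool) (fun s t =>
  s = triple None None (Some true) /\
  t = triple (Some true) (Some false) (Some false)).

(** Invariance under cyclic shifts in arity [n + 1]; arity [p] is therefore written [p.-1]. *)
Definition cyclic_condition n := @minor_condition 'I_n.+1 'I_n.+1 (fun s t =>
  s = @ordS n.+1 /\ t = id).

Lemma maltsev_intro (G : digraph) (f : dvert G -> dvert G -> dvert G -> dvert G) :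
  (forall x y z x' y' z', dedge x x' -> dedge y y' -> dedge z z' ->
     dedge (f x y z) (f x' y' z')) ->
  (forall x y z, f x x y = f y z z) -> maltsev G.
Proof.
move=> polf hf; pose o1 : 'I_3 := inord 1.
exists (fun u : {ffun 'I_3 -> dvert G} => f (u ord0) (u o1) (u ord_max)); split.
  by move=> u v huv; apply: polf.
by move=> s t [-> ->] x; rewrite !ffunE /triple /= inordK //= hf.
Qed.

Lemma maltsev_P2 : maltsev P2.
Proof.
apply: (@maltsev_intro P2 (fun x y z => if x == y then z else x)).
  move=> x y z x' y' z' /= /andP[hx hx'] _ /andP[hz hz'].
  by case: ifP => _; case: ifP => _; apply/andP.
by move=> x y z; rewrite eqxx; case: eqP.
Qed.

Lemma ltn_Cyc p (x : 'I_p.-1.+1) : 0 < p -> x < p.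
Proof. by move=> p0; apply: leq_trans (ltn_ord x) _; rewrite prednK. Qed.

Lemma Cyc_loopless p (x : dvert (Cyc p)) : 1 < p -> ~~ dedge x x.
Proof.
move=> p1; apply/negP=> /= /eqP xE; have := ltn_Cyc x (ltnW p1).
rewrite leq_eqVlt => /orP[/eqP e|/modn_small e].
  by rewrite e modnn in xE; rewrite -e xE in p1.
by rewrite e in xE; case: (n_Sn _ xE).
Qed.

(** The operation is [x - y + z] modulo [p]. *)
Lemma maltsev_Cyc p : 0 < p -> maltsev (Cyc p).
Proof.
move=> p0.
have lt m : m %% p < p.-1.+1 by rewrite prednK // ltn_pmod.
pose f (x y z : 'I_p.-1.+1) : 'I_p.-1.+1 := inord ((x + (p - y) + z) %% p).
have leyp (y : 'I_p.-1.+1) : y <= p by apply/ltnW/ltn_Cyc.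
apply: (@maltsev_intro (Cyc p) f) => [x y z x' y' z'|x y z].
  move=> /= /eqP hx /eqP hy /eqP hz; rewrite !inordK //; apply/eqP.
  rewrite -(addn1 (_ %% _)) modnDml; apply/eqP; rewrite -(eqn_modDr y').
  have -> : x' + (p - y') + z' + y' = x' + z' + p.
    by rewrite -addnA (addnC z') addnA -(addnA x') subnK // addnAC.
  rewrite modnDr hx hz modnDm {1}hy modnDmr.
  have -> : x + (p - y) + z + 1 + y.+1 = x.+1 + z.+1 + p.
    by have := leyp y; lia.
  by rewrite modnDr.
apply: val_inj; rewrite /= !inordK //.
rewrite subnKC // addnC modnDr.
by rewrite -addnA subnK // modnDr.
Qed.

(** The tuples [(0, 0, 1)] and [(1, 2, 2)] are joined by edges coordinatewise, yet the identity
    forces equal values, hence a loop. *)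
Lemma maltsev_T3 : ~ maltsev T3.
Proof.
case=> f [polf hf].
pose x (o : option bool) : 'I_3 :=
  match o with None => inord 0 | Some true => inord 1 | Some false => inord 2 end.
have := hf _ _ (conj erefl erefl) x; set u := finfun _; set v := finfun _ => uv.
have : dedge (f u) (f v).
  by apply: polf => -[[|[|[|//]]] hi]; rewrite !ffunE /triple /= !inordK.
by rewrite uv /= ltnn.
Qed.

(** The minimum ignores the order of its arguments and preserves a strict linear order. *)
Lemma cyclic_linear (G : digraph) (h : dvert G -> nat) n :
  injective h -> (forall x y, dedge x y = (h x < h y)) -> cyclic_condition n G.
Proof.
move=> injh eh.
pose am (u : {ffun 'I_n.+1 -> dvert G}) := [arg min_(i < ord0) h (u i)].
have amP (u : {ffun 'I_n.+1 -> dvert G}) i : h (u (am u)) <= h (u i).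
  by rewrite /am; case: arg_minnP => // j _; apply.
exists (fun u : {ffun 'I_n.+1 -> dvert G} => u (am u)); split=> [u v huv|s t [-> ->] x].
  by rewrite eh; apply: leq_ltn_trans (amP u (am v)) _; rewrite -eh.
apply: injh; set u := finfun _; set v := finfun _.
have uE i : u i = v (ordS i) by rewrite !ffunE.
have vE i : v i = u (ord_pred i) by rewrite uE ord_predK.
by apply/eqP; rewrite eqn_leq; apply/andP; split; [rewrite (vE (am v)) | rewrite (uE (am u))].
Qed.

(** Multiply the sum of the arguments by an inverse [a] of [n + 1] modulo [p]: raising all arguments
    by one then raises the result by one. *)
Lemma cyclic_Cyc_coprime p n : 0 < p -> coprime n.+1 p -> cyclic_condition n (Cyc p).
Proof.
move=> p0 cop.
have lt m : m %% p < p.-1.+1 by rewrite prednK // ltn_pmod.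
have [a b hab _] := egcdnP p (ltn0Sn n).
pose f (u : {ffun 'I_n.+1 -> 'I_p.-1.+1}) : 'I_p.-1.+1 := inord (a * (\sum_i u i) %% p).
exists f; split=> [u v /= huv|s t [-> ->] x]; last first.
  congr (inord (a * _ %% p)); rewrite [RHS](reindex_inj (@ordS_inj n.+1)).
  by apply: eq_bigr => i _; rewrite !ffunE.
rewrite !inordK //; apply/eqP.
rewrite (eq_bigr (fun i => (u i).+1 %% p)); last by move=> i _; apply/eqP.
rewrite -modnMmr modn_summ modnMmr -(addn1 (_ %% _)) modnDml.
rewrite (eq_bigr (fun i => u i + 1)); last by move=> i _; rewrite addn1.
rewrite big_split /= sum1_card card_ord mulnDr hab (eqP cop).
by rewrite addnCA modnMDl.
Qed.

(** The tuple [(0, ..., p - 1)] has edges to its cyclic shift in every coordinate, so invariance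
    would give a loop. *)
Lemma cyclic_Cyc p : 1 < p -> ~ cyclic_condition p.-1 (Cyc p).
Proof.
move=> p1 [f [polf hf]].
have := hf _ _ (conj erefl erefl) id; set u := finfun _; set v := finfun _ => uv.
have p0 := ltnW p1.
have : dedge (f v) (f u).
  by apply: polf => i; rewrite !ffunE /=; apply/eqP; congr (_ %% _); apply: prednK.
by rewrite uv (negPf (Cyc_loopless _ p1)).
Qed.

(** Let pairs forming an edge of [G] point to pairs with equal entries; without loops no pair is of
    both kinds. *)
Lemma ppc_P2_of_loopless (G : digraph) (a b : dvert G) :
  (forall x, ~~ @dedge G x x) -> dedge a b -> ppc G P2.
Proof.
move=> loopless hab.
pose x1 : bool + bool := inl true; pose x2 : bool + bool := inl false.
pose y1 : bool + bool := inr true; pose y2 : bool + bool := inr false.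
have hR := ppdef_and (ppdef_edge G x1 x2) (ppdef_eq G y1 y2).
pose f (i : 'I_2) (s : bool) := if (val i == 0) && ~~ s then b else a.
pose g (u : bool -> dvert G) : 'I_2 := inord (~~ dedge (u true) (u false)).
apply: (@ppc_intro G P2 bool _ f g hR) => [i j /andP[/= /eqP i0 /eqP j1]|u v /= [h1 h2]].
  by rewrite /f /= i0 j1.
by rewrite /g h1 h2 (negPf (loopless _)) !inordK.
Qed.

(** * Submaximality *)

Definition is_submax (X : digraph) := X = T3 \/ exists p, prime p /\ X = Cyc p.

Lemma submax_ppc_P2 X : is_submax X -> ppc X P2.
Proof.
case=> [->|[p [pp ->]]].
  apply: (@ppc_P2_of_loopless T3 ord0 ord_max) => // x.
  by rewrite /= ltnn.
have p1 := prime_gt1 pp; have p0 := ltnW p1.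
apply: (@ppc_P2_of_loopless (Cyc p) ord0 (inord 1)); last first.
  by rewrite /= inordK ?prednK // modn_small.
by move=> x; apply: Cyc_loopless.
Qed.

(** [P2] satisfies the Maltsev and all cyclic conditions; [T3] fails the former and [Cyc p] the
    cyclic one of arity [p]. *)
Lemma P2_not_ppc_submax X : is_submax X -> ~ ppc P2 X.
Proof.
case=> [-> h|[p [pp ->]] h].
  exact: maltsev_T3 (minor_condition_ppc ord0 h maltsev_P2).
apply: (cyclic_Cyc (prime_gt1 pp)); apply: (minor_condition_ppc ord0 h).
apply: (@cyclic_linear P2 val) => [|x y]; first exact: val_inj.
by case: x y => [[|[|//]] hx] [[|[|//]] hy].
Qed.

(** The cyclic condition of arity [q] fails in [Cyc q] but holds in [T3] and every other [Cyc p];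
    the Maltsev condition fails in [T3] but holds in each [Cyc p]. *)
Lemma submax_antichain X Y : is_submax X -> is_submax Y -> ppc X Y -> X = Y.
Proof.
case=> [->|[p [pp ->]]] [->|[q [pq ->]]] // h.
- case: (cyclic_Cyc (prime_gt1 pq)); apply: (minor_condition_ppc ord0 h).
  by apply: (@cyclic_linear T3 val) => //; apply: val_inj.
- by case: maltsev_T3; apply: (minor_condition_ppc ord0 h (maltsev_Cyc (prime_gt0 pp))).
have [->//|npq] := eqVneq p q.
case: (cyclic_Cyc (prime_gt1 pq)); apply: (minor_condition_ppc ord0 h).
apply: cyclic_Cyc_coprime; first exact: prime_gt0.
by rewrite prednK ?prime_gt0 // prime_coprime // dvdn_prime2 // eq_sym.
Qed.

Theorem mainTheorem1 :
  (forall G : digraph,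
     submaximal G <-> (ppeq G T3 \/ exists p : nat, prime p /\ ppeq G (Cyc p))) /\
  (forall G : digraph,
     ~ ppc P2 G -> ppc G T3 \/ exists p : nat, prime p /\ ppc G (Cyc p)).
Proof.
split; last exact: digraph_dichotomy.
move=> G.
have below H : ~ ppc P2 H -> exists2 X, is_submax X & ppc H X.
  case/digraph_dichotomy=> [h|[p [pp h]]]; first by exists T3; [left|].
  by exists (Cyc p) => //; right; exists p.
have -> : (ppeq G T3 \/ exists p, prime p /\ ppeq G (Cyc p))
    <-> exists2 X, is_submax X & ppeq G X.
  split=> [[h|[p [pp h]]]|[X [->|[p [pp ->]]] h]].
  - by exists T3; [left|].
  - by exists (Cyc p) => //; right; exists p.
  - by left.
  - by right; exists p.
split=> [[[GP PG] max]|[X sX [GX XG]]].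
  have [X sX GX] := below G PG; exists X => //; split=> //.
  (* Otherwise [X] would lie strictly between [G] and [P2]. *)
  apply: NNPP => nXG; apply: max; exists X; split; split=> //.
    exact: submax_ppc_P2.
  exact: P2_not_ppc_submax.
split; first split.
- exact: ppc_trans GX (submax_ppc_P2 sX).
- by move=> h; apply: (P2_not_ppc_submax sX); apply: ppc_trans h GX.
(* A digraph [H] strictly between constructs some [Y] of the list; the chain from [X] through [G]
   and [H] to [Y] forces [X = Y], so [H] constructs [G]. *)
case=> H [[GH nHG] [_ /below[Y sY HY]]]; apply: nHG.
suff XY : X = Y by rewrite -XY in HY; apply: ppc_trans HY XG.
by apply: submax_antichain => //; apply: ppc_trans (ppc_trans XG GH) HY.
Qed.
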